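(* For all $p,d\in\mathbb{N}$, the class $\mathcal{C}_{p,d}$ of all finite graphs $G$ with $\mathrm{Sep}(G,p)\le d$ that do not contain $K_{p,p}$ as a minor is $\mathrm{MSO}_2$-orderable.
   Context: Graphs are finite, simple, loop-free, undirected. For $G=\langle V,E\rangle$, $\lceil G\rceil=\langle V\cup E,\mathrm{inc}\rangle$ is the structure with universe $V\cup E$ and incidence relation $\mathrm{inc}\subseteq V\times E$. An MSO-formula $\varphi(x,y;Z_0,\dots,Z_{n-1})$ defines an order on a class $\mathcal{C}$ of structures if for every non-empty $\mathfrak{A}\in\mathcal{C}$ there are $P_0,\dots,P_{n-1}\subseteq A$ such that $\{(a,b):\mathfrak{A}\models\varphi(a,b;\bar P)\}$ is a linear order on $A$. A class of graphs $\mathcal{C}$ is $\mathrm{MSO}_2$-orderable if some MSO-formula defines an order on $\{\lceil G\rceil: G\in\mathcal{C}\}$. $\mathrm{Sep}(G,k)$ is the maximum over vertex sets $S$ with $|S|\le k$ of the number of connected components of $G-S$. *)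

(* Defs.v *)
From HB Require Import structures.
From mathcomp Require Import all_boot.
Set Implicit Arguments. Unset Strict Implicit. Unset Printing Implicit Defensive.

Definition simple_graph (T : finType) (e : rel T) : Prop :=
  symmetric e /\ irreflexive e.

Definition is_edge (T : finType) (e : rel T) (A : {set T}) : bool :=
  [exists x, exists y, e x y && (A == [set x; y])].

Definition edgeT (T : finType) (e : rel T) := {A : {set T} | is_edge e A}.

Definition inc_univ (T : finType) (e : rel T) : finType := (T + edgeT e)%type.

Definition inc_rel (T : finType) (e : rel T) : rel (inc_univ e) :=
  fun u w => match u, w with
             | inl v, inr E => v \in val E
             | _, _ => false
             end.

Definition del_rel (T : finType) (e : rel T) (S : {set T}) : rel T :=
  fun x y => [&& e x y, x \notin S & y \notin S].

Definition ncomp_del (T : finType) (e : rel T) (S : {set T}) : nat :=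
  n_comp (del_rel e S) [predC S].

Definition sep_le (T : finType) (e : rel T) (k d : nat) : Prop :=
  forall S : {set T}, #|S| <= k -> ncomp_del e S <= d.

Definition induced_rel (T : finType) (e : rel T) (A : {set T}) : rel T :=
  fun x y => [&& e x y, x \in A & y \in A].

Definition connected_set (T : finType) (e : rel T) (A : {set T}) : Prop :=
  forall x y, x \in A -> y \in A -> connect (induced_rel e A) x y.

Definition has_Kpp_minor (T : finType) (e : rel T) (p : nat) : Prop :=
  exists (A B : 'I_p -> {set T}),
    [/\ forall i, A i != set0 /\ B i != set0 /\
                  connected_set e (A i) /\ connected_set e (B i),
        forall i j, i != j -> [disjoint A i & A j] /\ [disjoint B i & B j],
        forall i j, [disjoint A i & B j]
      & forall i j, exists x y, [/\ x \in A i, y \in B j & e x y]].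

(* first-order variables and set variables are named by nat *)
Inductive mso : Type :=
| MRel of nat & nat
| MEq of nat & nat
| MIn of nat & nat
| MNot of mso
| MAnd of mso & mso
| MExV of nat & mso
| MExS of nat & mso.

Definition upd (A : Type) (v : nat -> A) (k : nat) (a : A) : nat -> A :=
  fun j => if j == k then a else v j.

Fixpoint msat (A : finType) (R : rel A) (v : nat -> A) (V : nat -> {set A})
    (f : mso) : Prop :=
  match f with
  | MRel x y => R (v x) (v y)
  | MEq x y => v x = v y
  | MIn x X => v x \in V X
  | MNot g => ~ msat R v V g
  | MAnd g h => msat R v V g /\ msat R v V h
  | MExV x g => exists a : A, msat R (upd v x a) V g
  | MExS X g => exists P : {set A}, msat R v (upd V X P) g
  end.

(* Well-scopedness of φ(x,y;Z_0..Z_{n-1}): free first-order variables among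
   0 (=x) and 1 (=y), free set variables among 0..n-1. *)
Fixpoint mso_wf (bf bs : seq nat) (n : nat) (f : mso) : bool :=
  let fo x := (x \in bf) || (x <= 1) in
  match f with
  | MRel x y => fo x && fo y
  | MEq x y => fo x && fo y
  | MIn x X => fo x && ((X \in bs) || (X < n))
  | MNot g => mso_wf bf bs n g
  | MAnd g h => mso_wf bf bs n g && mso_wf bf bs n h
  | MExV x g => mso_wf (x :: bf) bs n g
  | MExS X g => mso_wf bf (X :: bs) n g
  end.

Definition mso_rel (A : finType) (R : rel A) (n : nat) (f : mso)
    (P : 'I_n -> {set A}) (a b : A) : Prop :=
  msat R (fun k => if k == 0 then a else b)
         (fun k => match insub k with Some i => P i | None => set0 end) f.

Definition linear_order (A : Type) (r : A -> A -> Prop) : Prop :=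
  [/\ forall a, r a a,
      forall a b, r a b -> r b a -> a = b,
      forall a b c, r a b -> r b c -> r a c
    & forall a b, r a b \/ r b a].

Definition defines_order_on (n : nat) (f : mso) (A : finType) (R : rel A) : Prop :=
  0 < #|A| -> exists P : 'I_n -> {set A}, linear_order (@mso_rel A R n f P).

Definition MSO2_orderable (C : forall T : finType, rel T -> Prop) : Prop :=
  exists (n : nat) (f : mso), mso_wf [::] [::] n f /\
    forall (T : finType) (e : rel T), simple_graph e -> C T e ->
      @defines_order_on n f (inc_univ e) (@inc_rel T e).

Definition C_pd (p d : nat) (T : finType) (e : rel T) : Prop :=
  sep_le e p d /\ ~ has_Kpp_minor e p.

(* Main.v *)
(** A rooted spanning forest of maximal total depth is normal: every edge of the
    graph joins a vertex to one of its ancestors, since otherwise one end could be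
    re-hung, with its subtree, below the other. Let N(v) be the set of strict
    ancestors of v with a neighbour in the subtree of v. If k siblings share the same
    N, their subtrees are distinct components of G - N, so k <= d when |N| <= p; and
    when |N| > p, contracting p of these subtrees would give a K_{p,p} minor, so
    k <= p. Hence d + p colours separate siblings with the same N, and siblings are
    linearly ordered by comparing N lexicographically along the chain of ancestors,
    then the colours. The depth-first order so obtained on vertices, extended
    lexicographically to edges, is definable from the set of tree edges, the depths
    modulo 3 and the colours. *)
Require Import Defs.
From HB Require Import structures.
From mathcomp Require Import all_boot zify.
Set Implicit Arguments. Unset Strict Implicit. Unset Printing Implicit Defensive.

(** * Lexicographic comparison of sets *)

Section LexOrder.
Variables (A : finType) (lt : rel A).
Hypotheses (lt_irr : irreflexive lt) (lt_trans : transitive lt).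

(** The usual order on 0-1 strings, with [z] as a place of first difference; as [lt] may be partial,
    such a place need not be unique. *)
Definition lexlt (P Q : pred A) : bool :=
  [exists z, [&& ~~ P z, Q z & [forall w, lt w z ==> (P w == Q w)]]].

Lemma eq_lexlt (P P' Q Q' : pred A) : P =1 P' -> Q =1 Q' -> lexlt P Q = lexlt P' Q'.
Proof.
move=> eP eQ; apply: eq_existsb => z; rewrite eP eQ; congr [&& _, _ & _].
by apply: eq_forallb => w; rewrite eP eQ.
Qed.

Lemma lexlt_irr P : lexlt P P = false.
Proof. by apply/existsP => -[z /and3P[/negP nP /nP]]. Qed.

Lemma lexlt_total (P Q : pred A) :
  [|| lexlt P Q, lexlt Q P | [forall z, P z == Q z]].
Proof.
case: (boolP [forall z, _]); rewrite ?orbT // => /forallPn[z0 nz0].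
(* A difference with the fewest predecessors is [lt]-minimal, since anything below it has strictly
   fewer. *)
have [z nz zmin] := @arg_minnP _ z0 (fun z => P z != Q z)
  (fun z => #|[set w | lt w z]|) nz0.
have low w : lt w z -> P w = Q w.
  move=> lwz; case: (eqVneq (P w) (Q w)) => // /zmin; rewrite leqNgt => /negP[].
  apply: proper_card; apply/properP; split.
    by apply/subsetP => u; rewrite !inE => /lt_trans; apply.
  by exists w; rewrite !inE ?lwz // lt_irr.
rewrite orbF; case Pz: (P z) nz => nz; apply/orP.
  right; apply/existsP; exists z; rewrite Pz; case: (Q z) nz => //= _.
  by apply/forallP=> w; apply/implyP=> /low ->.
left; apply/existsP; exists z; rewrite Pz; case: (Q z) nz => //= _.
by apply/forallP=> w; apply/implyP=> /low ->.
Qed.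
Variable D : pred A.
Hypothesis lt_total : forall x y, D x -> D y -> x != y -> lt x y || lt y x.

(** The two places of first difference lie in [Q] and in [S], hence in the chain [D]; they are
    distinct, and the smaller one is a first difference of [P] and [S]. *)
Lemma lexlt_trans (P Q S : pred A) :
  subpred P D -> subpred Q D -> subpred S D ->
  lexlt P Q -> lexlt Q S -> lexlt P S.
Proof.
move=> PD QD SD /existsP[z /and3P[nPz Qz /forallP hz]].
move=> /existsP[y /and3P[nQy Sy /forallP hy]].
have nzy : z != y by apply: contraTneq Qz => ->.
have [ltzy|ltyz] := orP (lt_total (QD _ Qz) (SD _ Sy) nzy).
  apply/existsP; exists z; rewrite nPz /= -(eqP (implyP (hy z) ltzy)) Qz /=.
  apply/forallP=> w; apply/implyP=> lwz; rewrite (eqP (implyP (hz w) lwz)).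
  exact: implyP (hy w) (lt_trans lwz ltzy).
apply/existsP; exists y; rewrite (eqP (implyP (hz y) ltyz)) nQy Sy /=.
apply/forallP=> w; apply/implyP=> lwy; rewrite (eqP (implyP (hz w) (lt_trans lwy ltyz))).
exact: implyP (hy w) lwy.
Qed.
End LexOrder.

(** * Rooted forests and their ancestor order *)

Section Forest.
Variables (T : finType) (e : rel T).

(* [None] marks the roots. *)
Definition is_forest (par : T -> option T) (dep : T -> nat) : Prop :=
  forall v, if par v is Some u then e u v /\ dep v = (dep u).+1 else dep v = 0.

Definition anc (par : T -> option T) (u v : T) : bool :=
  connect (fun y x => par y == Some x) v u.

(** The property of depth-first search forests: no edge runs between separate branches. *)
Definition normal (par : T -> option T) : Prop :=
  forall x y, e x y -> anc par x y || anc par y x.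

Section Anc.
Variables (par : T -> option T) (dep : T -> nat).
Hypothesis forP : is_forest par dep.
Local Notation anc := (anc par).

Lemma anc_refl : reflexive anc.
Proof. by move=> x; apply: connect0. Qed.
Hint Resolve anc_refl : core.

Lemma anc_trans : transitive anc.
Proof. by move=> y x z xy yz; apply: connect_trans yz xy. Qed.

Lemma anc_par u v : par v = Some u -> anc u v.
Proof. by move=> h; apply: connect1; rewrite h. Qed.

Lemma par_dep u v : par v = Some u -> dep v = (dep u).+1.
Proof. by move=> h; have := forP v; rewrite h => -[]. Qed.

Lemma anc_inv u v : anc u v -> u = v \/ exists2 w, par v = Some w & anc u w.
Proof.
case/connectP=> [[|w s]] /=; first by left.
by case/andP=> /eqP h hs ->; right; exists w => //; apply/connectP; exists s.
Qed.

Lemma anc_ind_up (Q : T -> Prop) u :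
  Q u -> (forall w v, par v = Some w -> anc u w -> Q w -> Q v) ->
  forall v, anc u v -> Q v.
Proof.
move=> Qu step v; have [n] := ubnP (dep v); elim: n v => // n IH v.
rewrite ltnS => lev /anc_inv [<- //|[w hw uw]].
by apply: (step _ _ hw uw (IH _ _ uw)); rewrite (leq_trans _ lev) // (par_dep hw).
Qed.

Lemma anc_dep u v : anc u v -> dep u <= dep v.
Proof. by move: v; apply: anc_ind_up => // w v /par_dep -> _ /leqW. Qed.

Lemma anc_dep_eq u v : anc u v -> dep v <= dep u -> u = v.
Proof.
case/anc_inv => // -[w /par_dep hv /anc_dep uw]; rewrite hv => h.
by have := leq_trans h uw; rewrite ltnn.
Qed.

Lemma anc_anti u v : anc u v -> anc v u -> u = v.
Proof. by move=> uv /anc_dep; apply: anc_dep_eq. Qed.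

Lemma anc_chain x y v : anc x v -> anc y v -> anc x y || anc y x.
Proof.
move: v; apply: anc_ind_up => [->|w v hw xw IH]; first by rewrite orbT.
case/anc_inv => [->|[w']]; last by rewrite hw => -[<-].
by rewrite (anc_trans xw (anc_par hw)).
Qed.

(** A strict ancestor of [v] is an ancestor of its parent, which is also the parent of [w]. *)
Lemma anc_sib u v w : par v = par w -> anc u v -> u != v -> anc u w && (u != w).
Proof.
move=> pvw /anc_inv[->|[x px ux _]]; first by rewrite eqxx.
rewrite (anc_trans ux) ?anc_par -?pvw //=; apply: contraTneq ux => ->.
by apply/negP => /anc_dep; rewrite (@par_dep x) -?pvw // ltnn.
Qed.

Lemma sib_dep v w : par v = par w -> dep v = dep w.
Proof.
move=> pvw; have := forP v; have := forP w; rewrite pvw.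
by case: (par w) => [u [_ ->] [_ ->]|-> ->].
Qed.

Lemma sib_anc v w : par v = par w -> anc v w -> v = w.
Proof. by move=> /sib_dep h vw; apply: anc_dep_eq; rewrite ?h. Qed.

Lemma sib_desc v w x : par v = par w -> anc v x -> anc w x -> v = w.
Proof.
move=> pvw vx wx; have [|h] := orP (anc_chain vx wx); first exact: sib_anc.
by symmetry; apply: sib_anc h.
Qed.

(** Climbing from [v] meets every depth from [dep v] down to 0, so at least [dep v + 1] distinct
    depths occur among the vertices. *)
Lemma dep_ltn v : dep v < #|T|.
Proof.
have lower n : forall u, dep u = n -> forall k, k <= n -> exists x, dep x = k.
  elim: n => [u du k|n IH u du k]; first by rewrite leqn0 => /eqP ->; exists u.
  rewrite leq_eqVlt => /predU1P[->|]; first by exists u.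
  have := forP u; case: (par u) => [w [_]|]; rewrite du // => -[dw].
  exact: (IH w).
rewrite cardE -(size_map dep) -[(dep v).+1](size_iota 0).
apply: uniq_leq_size; first exact: iota_uniq.
move=> k; rewrite mem_iota ltnS => /= /(lower _ _ erefl) [x <-].
by rewrite map_f // mem_enum.
Qed.
End Anc.

(** * Existence of a normal spanning forest *)

Hypothesis e_sym : symmetric e.

(* Hanging the subtree of [x] below the neighbour [y] deepens all of it. *)
Lemma rehang par dep x y : is_forest par dep -> e x y -> dep x <= dep y ->
  ~~ anc par x y -> exists par' dep',
    is_forest par' dep' /\ \sum_v dep v < \sum_v dep' v.
Proof.
move=> forP exy lexy nxy.
pose par' v := if v == x then Some y else par v.
(* The subtree shifts by [dep y + 1 - dep x], positive since [dep x <= dep y]; adding first keeps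
   the truncated subtraction exact. *)
pose dep' v := if anc par x v then dep v + (dep y).+1 - dep x else dep v.
exists par', dep'; split.
  move=> v; rewrite /par' /dep'; case: eqVneq => [->|nvx].
    by rewrite anc_refl (negPf nxy) e_sym addKn.
  have := forP v; case pv: (par v) => [u|].
    case=> euv dv; split=> //; case: ifPn => xv.
      have xu : anc par x u.
        by have [xv'|[u']] := anc_inv xv; [rewrite xv' eqxx in nvx | rewrite pv => -[<-]].
      by rewrite xu dv; have := anc_dep forP xu; lia.
    by case: ifPn => // /anc_trans /(_ (anc_par pv)); rewrite (negPf xv).
  move=> dv; case: ifPn => // /anc_inv[xv|[u]]; last by rewrite pv.
  by rewrite xv eqxx in nvx.
rewrite (bigD1 x) //= [ltnRHS](bigD1 x) //= -addSn; apply: leq_add.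
  by rewrite /dep' anc_refl; lia.
by apply: leq_sum => v _; rewrite /dep'; case: ifP => // _; lia.
Qed.

Lemma normal_forest : exists par dep, is_forest par dep /\ normal par.
Proof.
(* Depths are below [#|T|], so the total depth never exceeds [#|T| * #|T|], and the gap to this
   bound is the induction measure. *)
have main k par dep : is_forest par dep -> #|T| * #|T| - \sum_v dep v < k ->
    exists par dep, is_forest par dep /\ normal par.
  elim: k par dep => // k IH par dep forP ltk.
  case: (boolP [forall x, forall y, e x y ==> (anc par x y || anc par y x)]) => [H|].
    by exists par, dep; split=> // x y; move/forallP/(_ x)/forallP/(_ y)/implyP: H.
  case/forallPn => x /forallPn[y]; rewrite negb_imply negb_or => /and3P[exy nxy nyx].
  have [par' [dep' [forP' ltd]]] : exists par' dep',
      is_forest par' dep' /\ \sum_v dep v < \sum_v dep' v.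
    have [lxy|/ltnW lyx] := leqP (dep x) (dep y); first exact: rehang forP exy lxy nxy.
    by apply: rehang forP _ lyx nyx; rewrite e_sym.
  apply: (IH _ _ forP').
  have : \sum_v dep' v <= #|T| * #|T|.
    rewrite -sum_nat_const; apply: leq_sum => v _; exact: ltnW (dep_ltn forP' v).
  lia.
(* Initially every vertex is a root. *)
exact: (@main _ (fun=> None) (fun=> 0)).
Qed.

(** * Attachment sets, twin siblings and colours *)

Section Normal.
Variables (par : T -> option T) (dep : T -> nat).
Hypotheses (forP : is_forest par dep) (normP : normal par).
Local Notation anc := (anc par).
Local Notation anc_refl := (anc_refl par).

Definition subtree (v : T) : {set T} := [set w | anc v w].

(** The set N(v). In a normal forest it consists of all vertices outside the subtree of [v] that
    have a neighbour inside. *)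
Definition attach (v : T) : {set T} :=
  [set u | [&& anc u v, u != v & [exists w, anc v w && e u w]]].

(** By normality [y] is below or above [x]. If above, it is comparable with [v], and a position
    strictly above [v] would put it into [attach v] because of the edge to [x]. *)
Lemma subtree_closed v x y : x \in subtree v -> e x y -> y \notin attach v -> y \in subtree v.
Proof.
rewrite !inE => vx exy nN; have [xy|yx] := orP (normP exy); first exact: anc_trans vx xy.
have [//|yv] := orP (anc_chain forP vx yx).
case: (eqVneq y v) nN => [->|nyv]; first by rewrite anc_refl.
by rewrite yv /= => /existsPn/(_ x); rewrite vx e_sym exy.
Qed.

Lemma subtree_connected v : connected_set e (subtree v).
Proof.
have up x : anc v x -> connect (induced_rel e (subtree v)) x v.
  move: x; apply: (anc_ind_up forP) => [|w x px vw IH]; first exact: connect0.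
  apply: connect_trans IH; apply: connect1; have := forP x; rewrite px => -[ewx _].
  by rewrite /induced_rel e_sym ewx !inE vw (anc_trans vw (anc_par px)).
have sym : connect_sym (induced_rel e (subtree v)).
  by apply: sym_connect_sym => a b; rewrite /induced_rel e_sym; congr (_ && _); rewrite andbC.
move=> x y; rewrite !inE => /up vx /up vy.
by apply: connect_trans vx _; rewrite sym.
Qed.

(** The vertex [v] is one of its own twins, and all roots count as siblings, sharing the value
    [None] of [par]. *)
Definition twins (v : T) : {set T} := [set w | (par w == par v) && (attach w == attach v)].

Lemma twins_inj v w x y : w \in twins v -> x \in twins v ->
  y \in subtree w -> y \in subtree x -> w = x.
Proof.
rewrite !inE => /andP[/eqP pw _] /andP[/eqP px _].
by apply: (sib_desc forP); rewrite pw px.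
Qed.

Lemma attach_subtree v : [disjoint subtree v & attach v].
Proof.
apply/pred0P => u /=; rewrite !inE; apply/negP => /and3P[vu uv /andP[nuv _]].
by rewrite (anc_anti forP vu uv) eqxx in nuv.
Qed.

(* The subtrees of the twins are distinct components of [G - attach v]. *)
Lemma card_twins_sep v : #|twins v| <= ncomp_del e (attach v).
Proof.
set S := attach v; have sym : connect_sym (del_rel e S).
  by apply: sym_connect_sym => a b; rewrite /del_rel e_sym; congr (_ && _); rewrite andbC.
have stay w y : w \in twins v -> connect (del_rel e S) w y -> y \in subtree w.
  move=> tw /connectP[s hs ->].
  suff walk b : path (del_rel e S) b s -> b \in subtree w -> last b s \in subtree w.
    by apply: walk hs _; rewrite inE anc_refl.
  elim: s b {hs} => //= a s IH b /andP[/and3P[eba _ aS] /IH hs] bw.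
  apply: hs; apply: subtree_closed bw eba _.
  by move: tw; rewrite inE => /andP[_ /eqP ->].
(* Each twin is mapped to the canonical representative of its component. The map is injective
   because, by [stay], a component never leaves the subtree of its twin. *)
rewrite -(@card_in_imset _ _ (root (del_rel e S))) => [|w x tw tx /eqP]; last first.
  rewrite root_connect // => cwx.
  by apply: (twins_inj tw tx (stay _ _ tw cwx)); rewrite inE anc_refl.
apply: subset_leq_card; apply/subsetP => _ /imsetP[w tw ->].
rewrite inE /= roots_root //=; have := stay _ _ tw (connect_root _ _).
move: tw; rewrite [w \in _]inE => /andP[_ /eqP tw].
by rewrite /S -tw => rw; apply: negbT (disjointFr (attach_subtree w) rw).
Qed.

(** The branch sets are [p] twin subtrees on one side and [p] single vertices of the common
    attachment set on the other; the definition of [attach] supplies the edges. *)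
Lemma twins_minor p v : p <= #|twins v| -> p <= #|attach v| -> has_Kpp_minor e p.
Proof.
move=> pK pS; pose K (i : 'I_p) := enum_val (widen_ord pK i).
pose S (i : 'I_p) := enum_val (widen_ord pS i).
have tK i : K i \in twins v by apply: enum_valP.
have tS i j : S j \in attach (K i).
  by move: (tK i); rewrite inE => /andP[_ /eqP ->]; apply: enum_valP.
have Kinj i j : K i = K j -> i = j by move/enum_val_inj/(congr1 val) => h; apply: val_inj.
have Sinj i j : S i = S j -> i = j by move/enum_val_inj/(congr1 val) => h; apply: val_inj.
exists (fun i => subtree (K i)), (fun i => [set S i]); split.
- move=> i; split; first by apply/set0Pn; exists (K i); rewrite inE anc_refl.
  split; first by apply/set0Pn; exists (S i); rewrite inE.
  split; first exact: subtree_connected.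
  by move=> x y; rewrite !inE => /eqP -> /eqP ->; apply: connect0.
- move=> i j nij; split; apply/pred0P => x /=; apply/negP => /andP[].
    move=> xi xj; move/eqP: nij; apply; apply: Kinj; exact: twins_inj xi xj.
  by rewrite !inE => /eqP -> /eqP /Sinj ij; rewrite ij eqxx in nij.
- move=> i j; apply/pred0P => x /=; apply/negP => /andP[xi].
  rewrite inE => /eqP xj; move: xi.
  by rewrite xj (disjointFl (attach_subtree (K i)) (tS i j)).
- move=> i j; have := tS i j; rewrite inE => /and3P[_ _ /existsP[w /andP[Kw ew]]].
  by exists w, (S j); rewrite !inE Kw eqxx e_sym ew.
Qed.

Lemma card_twins p d v : sep_le e p d -> ~ has_Kpp_minor e p -> #|twins v| <= d + p.
Proof.
move=> sepP minP; have [lS|/ltnW lS] := leqP #|attach v| p.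
  by rewrite (leq_trans (card_twins_sep v)) // (leq_trans (sepP _ lS)) ?leq_addr.
have [|lK] := leqP #|twins v| p; first by move/leq_trans; apply; apply: leq_addl.
by case: minP; apply: twins_minor lS; apply: ltnW lK.
Qed.

(** Twins have the same set [twins], hence the same enumeration of it, so their positions there tell
    them apart. *)
Definition colour (v : T) : nat := index v (enum (twins v)).

Lemma colour_lt v : colour v < #|twins v|.
Proof. by rewrite cardE index_mem mem_enum inE !eqxx. Qed.

Lemma colour_inj v w : par v = par w -> attach v = attach w -> colour v = colour w -> v = w.
Proof.
move=> pvw avw; rewrite /colour.
have -> : twins v = twins w by apply/setP => x; rewrite !inE pvw avw.
by apply: (index_inj v); rewrite mem_enum inE ?pvw ?avw !eqxx.
Qed.

(** * The sibling order and the depth-first order *)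

Definition sanc (u v : T) : bool := anc u v && (u != v).

Lemma sanc_irr : irreflexive sanc.
Proof. by move=> x; rewrite /sanc eqxx andbF. Qed.

Lemma sanc_trans : transitive sanc.
Proof.
move=> y x z /andP[xy nxy] /andP[yz nyz]; rewrite /sanc (anc_trans xy yz) /=.
by apply: contraNneq nxy => xz; rewrite (anc_anti forP xy) // xz.
Qed.

Definition prec (v w : T) : bool :=
  lexlt sanc (fun z => z \in attach v) (fun z => z \in attach w)
  || [forall z, (z \in attach v) == (z \in attach w)] && (colour v < colour w).

Lemma prec_irr : irreflexive prec.
Proof. by move=> v; rewrite /prec lexlt_irr ltnn andbF. Qed.

(** Siblings have the same strict ancestors. Their attachment sets therefore lie in one chain, as
    [lexlt_trans] requires. *)
Lemma attach_sanc v w : par v = par w -> subpred (fun z => z \in attach w) (fun u => sanc u v).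
Proof.
by move=> pvw u /=; rewrite inE => /and3P[uw nuw _]; exact: (anc_sib forP (esym pvw) uw nuw).
Qed.

Lemma sanc_total v x y : sanc x v -> sanc y v -> x != y -> sanc x y || sanc y x.
Proof.
move=> /andP[xv _] /andP[yv _] nxy; rewrite /sanc nxy eq_sym nxy !andbT.
exact: (anc_chain forP xv yv).
Qed.

Lemma prec_trans u v w : par u = par v -> par v = par w -> prec u v -> prec v w -> prec u w.
Proof.
move=> puv pvw; rewrite /prec.
case/orP=> [luv|/andP[/forallP auv cuv]]; case/orP=> [lvw|/andP[/forallP avw cvw]].
- rewrite (lexlt_trans (D := sanc^~ u) sanc_trans (@sanc_total u) _ _ _ luv lvw) //.
  + exact: attach_sanc.
  + exact: attach_sanc puv.
  + by apply: attach_sanc; rewrite puv.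
- by rewrite -(eq_lexlt _ (frefl _) (fun z => eqP (avw z))) luv.
- by rewrite (eq_lexlt _ (fun z => eqP (auv z)) (frefl _)) lvw.
- rewrite (ltn_trans cuv cvw) andbT; apply/orP; right; apply/forallP => z.
  by rewrite (eqP (auv z)).
Qed.

Lemma prec_total v w : par v = par w -> v != w -> prec v w || prec w v.
Proof.
move=> pvw nvw; rewrite /prec.
have /or3P[->|->|H] // := lexlt_total sanc_irr sanc_trans
  (fun z => z \in attach v) (fun z => z \in attach w); rewrite ?orbT //.
have aeq : attach v = attach w by apply/setP => z; apply/eqP/(forallP H).
have H' : [forall z, (z \in attach w) == (z \in attach v)].
  by apply/forallP=> z; rewrite aeq.
have -> : [forall z, (z \in attach v) == (z \in attach w)] by [].
rewrite H' /=; case: (ltngtP (colour v) (colour w)); rewrite ?orbT //.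
by move/(colour_inj pvw aeq) => h; rewrite h eqxx in nvw.
Qed.

(** Preorder traversal: ancestors come first, and otherwise the sibling branches holding [a] and [b]
    decide. Different trees are compared through their roots. *)
Definition vlt (a b : T) : bool :=
  sanc a b
  || [exists x, exists y, [&& anc x a, anc y b, par x == par y & prec x y]].

Lemma vlt_split x y a b : anc x a -> anc y b -> par x = par y -> prec x y -> vlt a b.
Proof.
move=> xa yb /eqP pxy xy; apply/orP; right; apply/existsP; exists x.
by apply/existsP; exists y; apply/and4P.
Qed.

Lemma vlt_irr : irreflexive vlt.
Proof.
move=> a; rewrite /vlt sanc_irr /=; apply/existsP => -[x /existsP[y /and4P[xa ya /eqP pxy]]].
by rewrite (sib_desc forP pxy xa ya) prec_irr.
Qed.

Lemma vlt_trans : transitive vlt.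
Proof.
move=> b a c /orP[ab|/existsP[x /existsP[y /and4P[xa yb /eqP pxy lxy]]]].
  case/orP => [bc|/existsP[y /existsP[z /and4P[yb zc /eqP pyz lyz]]]].
    by rewrite /vlt (sanc_trans ab bc).
  have [sab nab] := andP ab; have [->|nay] := eqVneq a y.
    exact: vlt_split (anc_refl _) zc pyz lyz.
  have [ay|ya] := orP (anc_chain forP sab yb); last exact: vlt_split ya zc pyz lyz.
  have sz : sanc a z by exact: (anc_sib forP pyz ay nay).
  have [<-|nzc] := eqVneq z c; first by rewrite /vlt sz.
  by rewrite /vlt (@sanc_trans z) // /sanc zc.
case/orP => [/andP[bc _]|/existsP[y' /existsP[z /and4P[y'b zc /eqP pyz lyz]]]].
  exact: vlt_split xa (anc_trans yb bc) pxy lxy.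
(* Both [y] and [y'] are ancestors of [b], hence comparable; the higher of the two branchings also
   separates [a] from [c]. *)
have [eyy|nyy] := eqVneq y y'.
  subst y'; apply: vlt_split xa zc _ (prec_trans _ _ lxy lyz) => //; by rewrite pxy.
have [yy'|y'y] := orP (anc_chain forP yb y'b).
  have /andP[yz _] := anc_sib forP pyz yy' nyy.
  exact: vlt_split xa (anc_trans yz zc) pxy lxy.
have /andP[y'x _] : anc y' x && (y' != x) by apply: (anc_sib forP (esym pxy) y'y); rewrite eq_sym.
exact: vlt_split (anc_trans y'x xa) zc pyz lyz.
Qed.

Lemma anc_root b : exists2 r, anc r b & par r = None.
Proof.
have [n] := ubnP (dep b); elim: n b => // n IH b; rewrite ltnS => leb.
case pb: (par b) => [u|]; last by exists b; rewrite ?anc_refl.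
have [|r ru pr] := IH u; first by rewrite (leq_trans _ leb) // (par_dep forP pb).
by exists r => //; apply: anc_trans ru (anc_par pb).
Qed.

Lemma anc_child u b : anc u b -> u != b -> exists2 y, anc y b & par y = Some u.
Proof.
move: b; apply: (anc_ind_up forP) => [|w v pv uw IH _]; first by rewrite eqxx.
case: (eqVneq u w) => [uw'|/IH[y yw py]].
  by exists v; rewrite ?anc_refl // pv uw'.
by exists y => //; apply: anc_trans yw (anc_par pv).
Qed.

(** Climb from [a] to the last vertex not above [b]. Its parent has another child above [b]; if it
    has no parent, the root above [b] serves. *)
Lemma diverge a b : ~~ anc a b -> ~~ anc b a -> exists x y,
  [/\ anc x a, anc y b, par x = par y & x != y].
Proof.
have [n] := ubnP (dep a); elim: n a => // n IH a; rewrite ltnS => lea Nab Nba.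
have Na y : anc y b -> a != y by apply: contraTneq => <-.
case pa: (par a) => [u|]; last first.
  by have [r rb pr] := anc_root b; exists a, r; rewrite anc_refl rb pr pa Na.
have ua := anc_par pa.
case: (boolP (anc u b)) => [ub|Nub].
  have [|y yb py] := anc_child ub; first by apply: contraNneq Nba => <-.
  by exists a, y; rewrite anc_refl yb py pa Na.
have [||| x [y [xu yb pxy nxy]]] := IH u => //.
- by rewrite (leq_trans _ lea) // (par_dep forP pa).
- by apply: contraNN Nba => /anc_trans; apply.
by exists x, y; rewrite (anc_trans xu ua).
Qed.

Lemma vlt_total a b : a != b -> vlt a b || vlt b a.
Proof.
move=> nab; case: (boolP (anc a b)) => [ab|Nab]; first by rewrite /vlt /sanc ab nab.
case: (boolP (anc b a)) => [ba|Nba]; first by rewrite orbC /vlt /sanc ba eq_sym nab.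
have [x [y [xa yb pxy nxy]]] := diverge Nab Nba.
have [h|h] := orP (prec_total pxy nxy); first by rewrite (vlt_split xa yb pxy h).
by rewrite (vlt_split yb xa (esym pxy) h) orbT.
Qed.
End Normal.
End Forest.

(** * Derived connectives and truth values of formulas *)

Definition fOr g h := MNot (MAnd (MNot g) (MNot h)).
Definition fImp g h := MNot (MAnd g (MNot h)).
Definition fIff g h := MAnd (fImp g h) (fImp h g).
Definition fAll x g := MNot (MExV x (MNot g)).
Definition fAllS X g := MNot (MExS X (MNot g)).
Definition fLex (lt : nat -> nat -> mso) (P Q : nat -> mso) z w :=
  MExV z (MAnd (MNot (P z)) (MAnd (Q z)
    (fAll w (fImp (lt w z) (fIff (P w) (Q w)))))).

Section Tests.
Variables (A : finType) (R : rel A).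

(** Over a finite universe satisfaction is decidable; attaching a boolean to each formula makes the
    connectives defined through [MNot] behave classically. *)
Definition tests (v : nat -> A) (V : nat -> {set A}) (f : mso) (b : bool) : Prop :=
  msat R v V f <-> b.

Variables (v : nat -> A) (V : nat -> {set A}).

Lemma tests_eq f b b' : tests v V f b -> b = b' -> tests v V f b'.
Proof. by move=> h <-. Qed.

Lemma tests_rel x y : tests v V (MRel x y) (R (v x) (v y)).
Proof. by []. Qed.

Lemma tests_eqv x y : tests v V (MEq x y) (v x == v y).
Proof. by split=> [/= ->|/eqP]. Qed.

Lemma tests_in x X : tests v V (MIn x X) (v x \in V X).
Proof. by []. Qed.

Lemma tests_not g b : tests v V g b -> tests v V (MNot g) (~~ b).
Proof. by move=> [h1 h2]; split=> [h|/negP h /h1 //]; apply/negP => /h2. Qed.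

Lemma tests_and g h b c :
  tests v V g b -> tests v V h c -> tests v V (MAnd g h) (b && c).
Proof. by move=> [g1 g2] [h1 h2]; split=> [[/g1 -> /h1 ->]|/andP[/g2 ? /h2 ?]]. Qed.

Lemma tests_exV x g p :
  (forall a, tests (upd v x a) V g (p a)) -> tests v V (MExV x g) [exists a, p a].
Proof.
by move=> h; split=> [[a /h pa]|/existsP[a /h pa]]; [apply/existsP|]; exists a.
Qed.

Lemma tests_exS X g p :
  (forall S, tests v (upd V X S) g (p S)) -> tests v V (MExS X g) [exists S, p S].
Proof.
by move=> h; split=> [[a /h pa]|/existsP[a /h pa]]; [apply/existsP|]; exists a.
Qed.
End Tests.

Section DerivedTests.
Variables (A : finType) (R : rel A) (v : nat -> A) (V : nat -> {set A}).
Local Notation tests := (tests R).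

Lemma tests_or g h b c :
  tests v V g b -> tests v V h c -> tests v V (fOr g h) (b || c).
Proof.
move=> hg hh; apply: tests_eq; first by apply/tests_not/tests_and; apply: tests_not; eassumption.
by rewrite negb_and !negbK.
Qed.

Lemma tests_imp g h b c :
  tests v V g b -> tests v V h c -> tests v V (fImp g h) (b ==> c).
Proof.
move=> hg hh; apply: tests_eq; first exact: tests_not (tests_and hg (tests_not hh)).
by rewrite negb_and negbK implybE.
Qed.

Lemma tests_iff g h b c :
  tests v V g b -> tests v V h c -> tests v V (fIff g h) (b == c).
Proof.
move=> hg hh; apply: tests_eq; first exact: tests_and (tests_imp hg hh) (tests_imp hh hg).
by case: b c {hg hh} => [] [].
Qed.

Lemma tests_all x g p :
  (forall a, tests (upd v x a) V g (p a)) -> tests v V (fAll x g) [forall a, p a].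
Proof.
move=> h; apply: tests_eq; first by apply/tests_not/tests_exV => a; apply/tests_not/h.
by rewrite negb_exists; apply: eq_forallb => a; rewrite negbK.
Qed.

Lemma tests_allS X g p :
  (forall S, tests v (upd V X S) g (p S)) -> tests v V (fAllS X g) [forall S, p S].
Proof.
move=> h; apply: tests_eq; first by apply/tests_not/tests_exS => a; apply/tests_not/h.
by rewrite negb_exists; apply: eq_forallb => a; rewrite negbK.
Qed.
End DerivedTests.

Lemma tests_lex (A : finType) (R : rel A) (v : nat -> A) (V : nat -> {set A})
    flt fP fQ z w (lt : rel A) (P Q : pred A) :
  (forall a, tests R (upd v z a) V (fP z) (P a)) ->
  (forall a, tests R (upd v z a) V (fQ z) (Q a)) ->
  (forall a b, tests R (upd (upd v z a) w b) V (fP w) (P b)) ->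
  (forall a b, tests R (upd (upd v z a) w b) V (fQ w) (Q b)) ->
  (forall a b, tests R (upd (upd v z a) w b) V (flt w z) (lt b a)) ->
  tests R v V (fLex flt fP fQ z w) (lexlt lt P Q).
Proof.
move=> Pz Qz Pw Qw lwz; apply: tests_exV => a.
apply: tests_and; first exact: tests_not.
apply: tests_and => //.
apply: tests_all => b.
by apply: tests_imp => //; apply: tests_iff.
Qed.

(** * Formulas for the forest and the order *)

(* The set variable 0 is kept for quantification; 1 is the set of vertices, 2 that of
   tree edges, 3, 4 and 5 are the vertices of depth 0, 1 and 2 modulo 3, and 6 + i
   holds the vertices of colour greater than i. Bound first-order variables are
   chosen apart from those of the formulas plugged in below them. *)
Definition fpar x y :=
  MExV 2 (MAnd (MIn 2 2) (MAnd (MRel x 2) (MAnd (MRel y 2)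
    (fOr (MAnd (MIn x 3) (MIn y 4))
    (fOr (MAnd (MIn x 4) (MIn y 5)) (MAnd (MIn x 5) (MIn y 3))))))).
(** Reachability expressed by quantifying over the sets that contain [y] and are closed under
    parents. *)
Definition fanc x y :=
  MAnd (MIn x 1) (MAnd (MIn y 1)
    (fAllS 0 (fImp (MAnd (MIn y 0)
      (fAll 3 (fAll 4 (fImp (MAnd (fpar 3 4) (MIn 4 0)) (MIn 3 0))))) (MIn x 0)))).
Definition fsanc x y := MAnd (fanc x y) (MNot (MEq x y)).
Definition fadj x y := MAnd (MNot (MEq x y)) (MExV 2 (MAnd (MRel x 2) (MRel y 2))).
Definition fattach x y := MAnd (fsanc x y) (MExV 5 (MAnd (fanc y 5) (fadj x 5))).
(** Comparing all possible parents also covers two roots, which have none; the guards exclude edges,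
    which have none either. *)
Definition fsib x y :=
  MAnd (MIn x 1) (MAnd (MIn y 1) (fAll 5 (fIff (fpar 5 x) (fpar 5 y)))).
(** Colours are stored in unary, so a smaller colour is witnessed by one set that contains [y] and
    misses [x]. The innermost [MNot (MEq x x)] is falsity, the empty disjunction. *)
Definition fcol (m : nat) x y :=
  foldr (fun k => fOr (MAnd (MNot (MIn x k)) (MIn y k))) (MNot (MEq x x)) (iota 6 m).
Definition fprec m x y :=
  MAnd (MIn x 1) (MAnd (MIn y 1)
    (fOr (fLex fsanc (fattach^~ x) (fattach^~ y) 6 7)
      (MAnd (fAll 6 (fIff (fattach 6 x) (fattach 6 y))) (fcol m x y)))).
Definition fvlt m x y :=
  fOr (fsanc x y)
    (MExV 8 (MExV 9 (MAnd (fanc 8 x) (MAnd (fanc 9 y) (MAnd (fsib 8 9) (fprec m 8 9)))))).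
Definition forder m :=
  fOr (MEq 0 1)
    (fOr (fvlt m 0 1)
    (fOr (MAnd (MIn 0 1) (MNot (MIn 1 1)))
      (MAnd (MNot (MIn 0 1)) (MAnd (MNot (MIn 1 1))
        (fLex (fvlt m) (MRel^~ 0) (MRel^~ 1) 10 11))))).

Lemma fcol_wf m bf bs x y :
  (x \in bf) || (x <= 1) -> (y \in bf) || (y <= 1) -> mso_wf bf bs (6 + m) (fcol m x y).
Proof.
move=> hx hy; rewrite /fcol; have : all (fun k => k < 6 + m) (iota 6 m).
  by apply/allP => k; rewrite mem_iota => /andP[].
by elim: (iota 6 m) => [|k s IH] /=; rewrite ?hx ?hy //= => /andP[-> /IH ->]; rewrite orbT.
Qed.

Lemma forder_wf m : mso_wf [::] [::] (6 + m) (forder m).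
Proof.
by rewrite /forder /fLex /fvlt /fprec /= !fcol_wf.
Qed.

(** * Correctness of the formulas *)

Section Definability.
Variables (T : finType) (e : rel T).
Hypotheses (e_sym : symmetric e) (e_irr : irreflexive e).
Variables (par : T -> option T) (dep : T -> nat).
Hypothesis forP : is_forest e par dep.
Variable m : nat.
Hypothesis colour_m : forall v, colour e par v < m.

Local Notation A := (inc_univ e).
Local Notation R := (@inc_rel T e).
Local Notation tests := (tests R).

Definition params (k : nat) : {set A} :=
  [set a : A | match a with
    | inl v => [|| k == 1, (2 < k < 6) && (dep v %% 3 == k - 3)
                 | (5 < k) && (k - 6 < colour e par v)]
    | inr E => (k == 2) &&
        [exists v, exists u, (par v == Some u) && (val E == [set u; v])]
    end].

(** Index 0 is left unconstrained so that the property survives the set quantifier of [fanc]. *)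
Definition good (V : nat -> {set A}) : Prop := forall k, 0 < k < 6 + m -> V k = params k.

Definition lift (r : rel T) : rel A :=
  fun a b => match a, b with inl u, inl w => r u w | _, _ => false end.

Lemma exists_inl (p : pred A) : (forall E, p (inr E) = false) ->
  [exists a, p a] = [exists u, p (inl u)].
Proof.
move=> h; apply/existsP/existsP => [[[u|E] pa]|[u pu]]; [by exists u | | by exists (inl u)].
by rewrite h in pa.
Qed.

Lemma forall_inl (p : pred A) : (forall E, p (inr E)) ->
  [forall a, p a] = [forall u, p (inl u)].
Proof. by move=> h; apply/forallP/forallP => [pa u|pu [u|E]]. Qed.

Lemma lexlt_inl (lt : rel T) (P Q : pred A) : (forall E, Q (inr E) = false) ->
  lexlt (lift lt) P Q = lexlt lt (fun u => P (inl u)) (fun u => Q (inl u)).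
Proof.
move=> hQ; rewrite /lexlt exists_inl => [|E]; last by rewrite hQ andbF.
apply: eq_existsb => z; rewrite forall_inl //.
Qed.

Section ParentTest.
Variables (v : nat -> A) (V : nat -> {set A}).
Hypothesis gV : good V.

Lemma good_upd S : good (upd V 0 S).
Proof. by move=> [|k] // h; apply: gV. Qed.

Lemma tests_vert x : tests v V (MIn x 1) (if v x is inl _ then true else false).
Proof. by apply: tests_eq (tests_in _ _ _ _ _) _; rewrite gV // inE; case: (v x). Qed.

(** The ends of a tree edge have depths differing by one, and adding 1 and subtracting 1 differ
    modulo 3, so the residues show which end is the parent. *)
Lemma tests_par x y : x != 2 -> y != 2 ->
  tests v V (fpar x y) (lift (fun u w => par w == Some u) (v x) (v y)).
Proof.
move=> /negPf nx /negPf ny; apply: tests_eq.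
  apply: tests_exV => E; apply: tests_and; first exact: tests_in.
  apply: tests_and; first exact: tests_rel.
  apply: tests_and; first exact: tests_rel.
  by do 2?[apply: tests_or]; apply: tests_and; apply: tests_in.
rewrite /upd /= nx ny !gV //.
case: (v x) => [u|E]; case: (v y) => [w|E'] /=; last 2 first.
- by apply/existsP => -[[?|?]]; rewrite !andbF.
- by apply/existsP => -[[?|?]]; rewrite !andbF.
- apply/existsP/eqP => [[[b|E]]|pw]; first by rewrite andbF.
    rewrite !inE /= => /and4P[/existsP[w' /existsP[u' /andP[/eqP pw' /eqP ->]]]].
    rewrite !inE => hu hw hd; have dw := par_dep forP pw'.
    by case/orP: hu hd => /eqP ->; case/orP: hw => /eqP -> //; lia.
  have := forP w; rewrite pw => -[euw dw].
  have isE : is_edge e [set u; w].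
    by apply/existsP; exists u; apply/existsP; exists w; rewrite euw /=.
  exists (inr (Sub [set u; w] isE : edgeT e)); rewrite !inE /= !eqxx orbT /=.
  apply/andP; split; last by lia.
  by apply/existsP; exists w; apply/existsP; exists u; rewrite pw /= !eqxx.
- by apply/existsP => -[[?|?]]; rewrite !andbF.
Qed.
End ParentTest.

Lemma tests_anc v V x y : good V -> tests v V (fanc x y) (lift (anc par) (v x) (v y)).
Proof.
move=> gV; apply: tests_eq.
  apply: tests_and; first exact: tests_vert.
  apply: tests_and; first exact: tests_vert.
  apply: tests_allS => S; have gS := good_upd gV S; apply: tests_imp; last exact: tests_in.
  apply: tests_and; first exact: tests_in.
  apply: tests_all => a; apply: tests_all => b; apply: tests_imp; last exact: tests_in.
  by apply: tests_and; [apply: tests_par | apply: tests_in].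
case: (v x) => [u|E] //; case: (v y) => [w|E'] //=; rewrite /upd /=.
(* The set of ancestors of [w] contains [w] and is closed under parents, so it is the set to
   test. *)
apply/forallP/idP => [/(_ [set a : A | if a is inl z then anc par z w else false])|uw S].
  rewrite !inE anc_refl /= => /implyP; apply; apply/forallP => a; apply/forallP => b.
  apply/implyP; rewrite !inE; case: a b => [a|?] [b|?] //= /andP[/eqP pb].
  exact: anc_trans (anc_par pb).
apply/implyP => /andP[wS /forallP clS]; move: w uw wS.
apply: (anc_ind_up forP) => // z w pw uz IH wS; apply: IH.
move/forallP/(_ (inl w))/implyP: (clS (inl z)); apply.
by rewrite /= pw eqxx.
Qed.

Section FormulaTests.
Variables (V : nat -> {set A}).
Hypothesis gV : good V.

Lemma tests_sanc v x y : tests v V (fsanc x y) (lift (sanc par) (v x) (v y)).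
Proof.
apply: tests_eq.
  by apply: tests_and; [apply: tests_anc | apply/tests_not/tests_eqv].
by case: (v x) => [u|E] //; case: (v y) => [w|E'].
Qed.

Lemma tests_adj v x y : x != 2 -> y != 2 -> tests v V (fadj x y) (lift e (v x) (v y)).
Proof.
move=> /negPf nx /negPf ny; apply: tests_eq.
  apply: tests_and; first exact/tests_not/tests_eqv.
  by apply: tests_exV => E; apply: tests_and; apply: tests_rel.
rewrite /upd /= nx ny.
case: (v x) => [u|E]; case: (v y) => [w|E']; last 2 first.
- by apply/andP => -[_ /existsP[[?|?]]].
- by apply/andP => -[_ /existsP[[?|?]]].
- rewrite /=; apply/andP/idP => [[nuw /existsP[[b|E]]]|euw] //=.
    case/existsP: (valP E) => a /existsP[b /andP[eab /eqP ->]]; rewrite !inE.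
    move=> /andP[hu hw]; move: nuw.
    by case/orP: hu => /eqP ->; case/orP: hw => /eqP ->; rewrite ?eqxx // e_sym.
  split; first by apply: contraTneq euw => -[->]; rewrite /= e_irr.
  have isE : is_edge e [set u; w].
    by apply/existsP; exists u; apply/existsP; exists w; rewrite euw /=.
  by apply/existsP; exists (inr (Sub [set u; w] isE : edgeT e)); rewrite /= !inE !eqxx orbT.
- by apply/andP => -[_ /existsP[[?|?]]]; rewrite /= ?andbF.
Qed.

Lemma tests_attach v x y : x != 2 -> x != 5 -> y != 5 ->
  tests v V (fattach x y) (lift (fun u w => u \in attach e par w) (v x) (v y)).
Proof.
move=> nx2 /negPf nx /negPf ny; apply: tests_eq.
  apply: tests_and; first exact: tests_sanc.
  by apply: tests_exV => a; apply: tests_and; [apply: tests_anc | apply: tests_adj].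
rewrite /upd /= nx ny; case: (v x) => [u|E] //; case: (v y) => [w|E'] //=.
by rewrite exists_inl // inE /sanc andbA.
Qed.

Lemma tests_sib v x y : x != 2 -> x != 5 -> y != 2 -> y != 5 ->
  tests v V (fsib x y) (lift (fun u w => par u == par w) (v x) (v y)).
Proof.
move=> nx2 /negPf nx ny2 /negPf ny; apply: tests_eq.
  apply: tests_and; first exact: tests_vert.
  apply: tests_and; first exact: tests_vert.
  by apply: tests_all => a; apply: tests_iff; apply: tests_par.
rewrite /upd /= nx ny; case: (v x) => [u|E] //; case: (v y) => [w|E'] //=.
rewrite forall_inl //=; apply/forallP/eqP => [h|-> //].
case pu: (par u) => [z|]; first by have := h z; rewrite pu eqxx eq_sym => /eqP/eqP ->.
case pw: (par w) => [z|] //; by have := h z; rewrite pu pw eqxx.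
Qed.

Lemma tests_col v x y :
  tests v V (fcol m x y) (has (fun k => (v x \notin V k) && (v y \in V k)) (iota 6 m)).
Proof.
rewrite /fcol; elim: (iota 6 m) => [|k s IH] /=.
  by apply: tests_eq; [apply/tests_not/tests_eqv | rewrite eqxx].
apply: tests_or => //; apply: tests_and; last exact: tests_in.
exact/tests_not/tests_in.
Qed.

Lemma colour_has u w :
  has (fun k => (inl u \notin V k) && (inl w \in V k)) (iota 6 m)
  = (colour e par u < colour e par w).
Proof.
apply/hasP/idP => [[k]|luw].
  rewrite mem_iota => /andP[k6 km]; rewrite gV ?km ?(leq_trans _ k6) // !inE /=.
  by lia.
(* This index holds the vertices of colour greater than that of [u]: it just misses [u], and [um]
   keeps it in range. *)
have um := colour_m u; exists (6 + colour e par u); first by rewrite mem_iota; lia.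
by rewrite gV ?inE; lia.
Qed.

Lemma tests_prec v : tests v V (fprec m 8 9) (lift (prec e par) (v 8) (v 9)).
Proof.
pose N a b := lift (fun u w => u \in attach e par w) a b.
apply: tests_eq.
  apply: tests_and; first exact: tests_vert.
  apply: tests_and; first exact: tests_vert.
  apply: tests_or.
    by apply: (tests_lex (lt := lift (sanc par)) (P := N^~ (v 8)) (Q := N^~ (v 9))) => *;
      (exact: tests_attach || exact: tests_sanc).
  apply: tests_and; last exact: tests_col.
  by apply: tests_all => a; apply: tests_iff; apply: tests_attach.
rewrite /upd /=; case: (v 8) => [u|E] //; case: (v 9) => [w|E'] //=.
by rewrite /prec colour_has forall_inl // lexlt_inl.
Qed.

Lemma tests_vlt v x y : x != 8 -> x != 9 -> y != 8 -> y != 9 ->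
  tests v V (fvlt m x y) (lift (vlt e par) (v x) (v y)).
Proof.
move=> /negPf x8 /negPf x9 /negPf y8 /negPf y9; apply: tests_eq.
  apply: tests_or; first exact: tests_sanc.
  apply: tests_exV => a; apply: tests_exV => b.
  apply: tests_and; first exact: tests_anc.
  apply: tests_and; first exact: tests_anc.
  by apply: tests_and; [apply: tests_sib | apply: tests_prec].
rewrite /upd /= x8 x9 y8 y9.
case: (v x) => [u|E]; last by apply/existsP => -[[a|a] /existsP[b]].
case: (v y) => [w|E']; last by apply/existsP => -[a /existsP[[b|b]]]; rewrite /= andbF.
rewrite /vlt /=; congr (_ || _); rewrite exists_inl => [|E]; last by apply/existsP => -[].
by apply: eq_existsb => a; rewrite exists_inl // => E; rewrite /= andbF.
Qed.

(** * The linear order on vertices and edges *)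

Definition uorder (a b : A) : bool :=
  [|| a == b, lift (vlt e par) a b | match a, b with
    | inl _, inr _ => true
    | inr _, inr _ => lexlt (lift (vlt e par)) (R^~ a) (R^~ b)
    | _, _ => false
    end].

Lemma tests_order v : tests v V (forder m) (uorder (v 0) (v 1)).
Proof.
apply: tests_eq.
  apply: tests_or; first exact: tests_eqv.
  apply: tests_or; first exact: tests_vlt.
  apply: tests_or.
    by apply: tests_and; last apply: tests_not; apply: tests_vert.
  apply: tests_and; first exact/tests_not/tests_vert.
  apply: tests_and; first exact/tests_not/tests_vert.
  apply: (tests_lex (lt := lift (vlt e par)) (P := R^~ (v 0)) (Q := R^~ (v 1))) => *;
    by [exact: tests_rel | exact: tests_vlt].
by rewrite /uorder; case: (v 0) => [u|E]; case: (v 1) => [w|E'] //=; rewrite ?orbF.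
Qed.
End FormulaTests.

Lemma lift_vlt_irr : irreflexive (lift (vlt e par)).
Proof. by case=> //= u; apply: vlt_irr forP u. Qed.

Lemma lift_vlt_trans : transitive (lift (vlt e par)).
Proof. by move=> [b|?] [a|?] [c|?] //=; apply: vlt_trans forP b a c. Qed.

Lemma uorder_linear : linear_order uorder.
Proof.
have vtrans := lift_vlt_trans; have virr := lift_vlt_irr.
(* Ends of edges are vertices, and [vlt] is total on these; they form the chain required by
   [lexlt_trans]. *)
pose D (a : A) := if a is inl _ then true else false.
have Rsub E : subpred (R^~ E) D by case.
have vtotal x y : D x -> D y -> x != y -> lift (vlt e par) x y || lift (vlt e par) y x.
  case: x y => [u|//] [w|//] _ _ nuw; apply: (vlt_total forP).
  by apply: contraNneq nuw => ->.
pose E_trans := lexlt_trans vtrans vtotal (Rsub _) (Rsub _) (Rsub _).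
split.
- by move=> a; rewrite /uorder eqxx.
- move=> a b /predU1P[//|/= hab] /predU1P[//|/= hba]; exfalso; move: hab hba.
  case: a b => [a|E] [b|F] //=; rewrite ?orbF.
    by move=> ab ba; have := vtrans (inl b) (inl a) (inl a) ab ba; rewrite virr.
  by move=> ab ba; have := E_trans _ _ _ ab ba; rewrite lexlt_irr.
- move=> a b c /predU1P[-> //|/= hab] /predU1P[<- //|/= hbc].
  rewrite /uorder; apply/orP; right; move: hab hbc.
  case: a b c => [a|E] [b|F] [c|G] //=; rewrite ?orbF //.
    exact: vtrans (inl b) (inl a) (inl c).
  exact: E_trans.
- move=> a b; apply/orP; rewrite /uorder; case: (eqVneq a b) => //= nab.
  case: a b nab => [a|E] [b|F] //= nab; rewrite ?orbF //.
    exact: (vtotal (inl a) (inl b)).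
  (* In the remaining case both edges have the same ends, and an edge is the set of its ends. *)
  have /or3P[->|->|/forallP h] // := lexlt_total virr vtrans (R^~ (inr E)) (R^~ (inr F)).
    by rewrite orbT.
  by case/eqP: nab; congr inr; apply/val_inj/setP => z; apply/eqP/(h (inl z)).
Qed.
End Definability.

Theorem theorem4p12 (p d : nat) : MSO2_orderable (C_pd p d).
Proof.
(* Indices below 6 have fixed roles; [d + p] further sets store the colours in unary, which suffices
   by the bound on twins. *)
exists (6 + (d + p)), (forder (d + p)); split; first exact: forder_wf.
move=> T e [e_sym e_irr] [sepP minP] _.
have [par [dep [forP normP]]] := normal_forest e_sym.
have colour_m v : colour e par v < d + p.
  exact: leq_trans (colour_lt _ _ _) (card_twins e_sym forP normP v sepP minP).
exists (fun i => params e par dep i).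
set r := mso_rel _ _ _.
have rE a b : r a b <-> uorder par a b.
  apply: (tests_order e_sym e_irr forP colour_m _ (fun k => if k == 0 then a else b)).
  by move=> k /andP[_ km]; rewrite insubT.
have [l1 l2 l3 l4] := uorder_linear forP.
split.
- by move=> a; apply/rE.
- by move=> a b /rE ab /rE ba; apply: l2.
- by move=> a b c /rE ab /rE bc; apply/rE; apply: l3 ab bc.
- by move=> a b; case: (l4 a b) => h; [left|right]; apply/rE.
Qed.
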